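(* Let $(T_n)_{n\ge1}$ be any sequence of random finite rooted trees such that $T_n$ has $n+1$ vertices, and suppose there is $D>1$ such that the heights $H(T_n)$ satisfy $$\forall\varepsilon>0,\quad \mathbb P\bigl(H(T_n)\ge n^{\frac1D+\varepsilon}\bigr)\xrightarrow[n\to+\infty]{}0.$$ Consider $T_n$-walks in $\mathbb Z^d$ whose centered jump distribution $\theta$ has finite absolute moment of order $\delta$ for all $\delta<2D$. If $d<2D$, then the $T_n$-walks are recurrent, in the sense that $$\frac{R^\theta(T_n)}{n}\longrightarrow 0\quad\text{in probability as }n\to+\infty.$$
   Context: $\theta$ is a centered probability distribution on $\mathbb Z^d$ with invertible covariance matrix. The height of a finite rooted tree $T$ is the maximal graph distance from the root to a vertex. A $T$-walk in $\mathbb Z^d$ with $\theta$-jumps is $(W_T(u))_{u\in T}$ with $W_T(\text{root})=0$ and such that, given the tree, the increments $W_T(u)-W_T(v)$ over the edges from a parent $v$ to a child $u$ are i.i.d. with law $\theta$. Its range is $R^\theta(T)=\#\{W_T(u):u\in T\}$. *)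

(* Defs.v *)
From HB Require Import structures.
From mathcomp Require Import all_boot all_order all_algebra.
From mathcomp Require Import all_classical all_reals all_analysis.

Set Implicit Arguments.
Unset Strict Implicit.
Unset Printing Implicit Defensive.

Import Order.TTheory GRing.Theory Num.Theory.
Import numFieldNormedType.Exports.

Local Open Scope classical_set_scope.
Local Open Scope ring_scope.

(* ucycle e [:: x; y] only says that x and y are adjacent, so that the cycles
   of a simple graph are the simple closed paths with at least 3 vertices. *)
Definition is_tree (V : finType) (e : rel V) : Prop :=
  [/\ symmetric e, irreflexive e, forall x y, connect e x y
    & forall c : seq V, ucycle e c -> (size c <= 2)%N].

Definition adj (V : finType) (E : {set V * V}) : rel V :=
  [rel x y | (x, y) \in E].

(* An edge set (as a set of ordered pairs) together with a root; the n + 1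
   vertices are labelled by 'I_n.+1 in an arbitrary way. *)
Definition rooted_tree (n : nat) : Type :=
  {g : {set 'I_n.+1 * 'I_n.+1} * 'I_n.+1 | `[< is_tree (adj g.1) >]}.
HB.instance Definition _ n := Finite.on (rooted_tree n).

Definition tadj n (t : rooted_tree n) : rel 'I_n.+1 := adj (val t).1.
Definition troot n (t : rooted_tree n) : 'I_n.+1 := (val t).2.

(* Least length of a path from x to y, or #|V| if there is none (a shortest
   path has no repeated vertex, hence length less than #|V|). *)
Definition gdist (V : finType) (e : rel V) (x y : V) : nat :=
  find (fun k => [exists p : k.-tuple V, path e x p && (last x p == y)])
       (iota 0 #|V|).

Definition depth n (t : rooted_tree n) (u : 'I_n.+1) : nat :=
  gdist (tadj t) (troot t) u.

Definition height n (t : rooted_tree n) : nat :=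
  (\max_(u : 'I_n.+1) depth t u)%N.

Definition is_parent n (t : rooted_tree n) (v u : 'I_n.+1) : bool :=
  tadj t v u && (depth t u == (depth t v).+1).

(* Z^d with the discrete sigma-algebra. *)
Definition lattice (d : nat) : Type := 'rV[int]_d.
HB.instance Definition _ d := GRing.Zmodule.on (lattice d).
HB.instance Definition _ d := isPointed.Build (lattice d) 0.
HB.instance Definition _ d := @isMeasurable.Build default_measure_display
  (lattice d) discrete_measurable discrete_measurable0
  discrete_measurableC discrete_measurableU.

Definition coord (R : realType) d (i : 'I_d) (x : lattice d) : R :=
  (x ord0 i)%:~R.

Definition enorm (R : realType) d (x : lattice d) : R :=
  Num.sqrt (\sum_(i < d) coord R i x ^+ 2).

Definition centered (R : realType) d (theta : probability (lattice d) R) :=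
  forall i : 'I_d, theta.-integrable setT (EFin \o coord R i) /\
                   ('E_theta[coord R i] = 0)%E.

Definition cov_mx (R : realType) d (theta : probability (lattice d) R) :
  'M[R]_d := \matrix_(i, j) fine (covariance theta (coord R i) (coord R j)).

Definition finite_moment (R : realType) d (theta : probability (lattice d) R)
  (delta : R) : Prop := ('E_theta[fun x => (enorm R x `^ delta)%R] < +oo)%E.

(* T is a random tree and W a T-walk with theta-jumps. The last field says that
   conditionally on T = t, the increments over the edges (indexed by their
   child, i.e. by the vertices other than the root) are i.i.d. of law theta. *)
Record is_tree_walk (R : realType) d (theta : probability (lattice d) R)
    (dO : measure_display) (Omega : measurableType dO)
    (P : probability Omega R) n
    (T : Omega -> rooted_tree n) (W : Omega -> 'I_n.+1 -> lattice d) : Prop :=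
  IsTreeWalk {
    tree_measurable : forall A : set (rooted_tree n), measurable (T @^-1` A) ;
    walk_measurable : forall u, measurable_fun setT (fun w => W w u) ;
    walk_root : forall w, W w (troot (T w)) = 0 ;
    walk_increments : forall (t : rooted_tree n) (A : 'I_n.+1 -> set (lattice d)),
      P [set w | T w = t /\
                 forall v u, is_parent t v u -> A u (W w u - W w v)] =
      (P [set w | T w = t] *
       (\prod_(u | u != troot t) fine (theta (A u)))%:E)%E }.

Definition walk_range d n (X : 'I_n.+1 -> lattice d) : nat :=
  size (undup (codom X)).

Definition cvg_in_probability (R : realType) (dO : nat -> measure_display)
    (Omega : forall n, measurableType (dO n))
    (P : forall n, probability (Omega n) R)
    (X : forall n, Omega n -> R) (c : R) : Prop :=
  forall e : R, 0 < e ->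
    (P n [set w | (e < `|X n w - c|)%R] @[n --> \oo] --> 0)%E.

(* Main.v *)
Require Import Defs.
From mathcomp Require Import all_boot all_order all_algebra.
From mathcomp Require Import all_classical all_reals all_analysis.
From mathcomp Require Import measurable_realfun zify ring lra.

(** The range is small because almost every vertex of the tree sits in a box
    with o(n) points, and each remaining vertex adds at most one point.

    Let the height of the tree be at most h = n^(1/D + eps).  Conditionally on
    the tree, the displacement at a vertex u is the sum of the increments along
    the ancestral line of u; these are at most h in number, centered and
    pairwise independent, so the second moment of each coordinate of the
    displacement is at most h times that of theta.  By Chebyshev's inequality
    the probability that a given coordinate at u reaches r = n^(1/(2D) + eps) is
    of order h / r^2 = n^(-eps).  By Markov's inequality the proportion of
    vertices lying outside the box of radius r tends to 0 in probability.  The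
    box has order r^d = n^(d/(2D) + d eps) points, which is o(n) when eps is
    small, exactly because d < 2D.  The second moment of theta is finite
    because 2 < 2D.

    On the tree side, acyclicity makes the parent of a vertex unique
    ([parent_unique]), which turns the product formula satisfied by the
    increments into a joint law, one increment per vertex other than the root;
    [ancestors_exist] writes a displacement as a sum of such increments.  Their
    orthogonality ([integral_mul_indep_centered]) gives the second moment
    [integral_walk_sqr] and the deviation bound [walk_chebyshev_height].  The
    deterministic bound [walk_range_le] on the range then leads to the estimate
    [walk_range_prob_le] for a fixed number of vertices, and the theorem is its
    limit. *)

Import Order.TTheory GRing.Theory Num.Theory.
Import numFieldNormedType.Exports.

Local Open Scope classical_set_scope.
Local Open Scope ring_scope.

Set Implicit Arguments.
Unset Strict Implicit.
Unset Printing Implicit Defensive.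

(* The name is also that of the coordinates of a vector in a basis. *)
Local Notation coord := Defs.coord.

(** * Distances and parents in a rooted tree *)

(** The search defining [gdist] stops at #|V|, so a path longer than that
    satisfies the bound as well. *)
Lemma gdist_le_size (V : finType) (e : rel V) x y (p : seq V) :
  path e x p -> last x p = y -> (gdist e x y <= size p)%N.
Proof.
move=> ep py; rewrite /gdist; set a := (fun k : nat => _).
case: (leqP #|V| (size p)) => [le_Vp|lt_pV].
  by rewrite (leq_trans (find_size _ _))// size_iota.
rewrite leqNgt; apply/negP => /(before_find 0%N).
rewrite nth_iota// add0n /a => /negbT/negP; apply.
by apply/existsP; exists (in_tuple p); rewrite ep py eqxx.
Qed.

(** A path without repetition has fewer than #|V| edges, hence lies in the range
    explored by [gdist]. *)
Lemma connect_shortest (V : finType) (e : rel V) x y : connect e x y ->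
  exists p : seq V, [/\ path e x p, last x p = y & size p = gdist e x y].
Proof.
move=> /connectP[p0 /shortenP[p ep /card_uniqP up _] ->].
rewrite /gdist; set a := (fun k : nat => _); set y' := last x p in a *.
have lt_pV : (size p < #|V|)%N by rewrite (leq_trans _ (max_card [in x :: p])) ?up.
have has_a : has a (iota 0 #|V|).
  apply/hasP; exists (size p); first by rewrite mem_iota.
  by apply/existsP; exists (in_tuple p); rewrite ep eqxx.
have := nth_find 0%N has_a; rewrite nth_iota ?add0n; last first.
  by move: has_a; rewrite has_find size_iota.
move=> /existsP[q /andP[eq /eqP lq]].
by exists q; split; rewrite // size_tuple.
Qed.

Section Tree.
Variables (n : nat) (t : rooted_tree n).
Local Notation root := (troot t).
Implicit Types u v : 'I_n.+1.

Lemma tree_axioms : is_tree (tadj t).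
Proof. exact/asboolP/(valP t). Qed.

Lemma depth_root : depth t root = 0%N.
Proof. by apply/eqP; rewrite -leqn0; apply: (@gdist_le_size _ _ _ _ [::]). Qed.

Lemma depth_gt0 u : u != root -> (0 < depth t u)%N.
Proof.
have [_ _ conn _] := tree_axioms.
have [[|v p] [//= _ lp sp]] := connect_shortest (conn root u).
  by rewrite lp eqxx.
by rewrite /depth -sp.
Qed.

Lemma depth_adj_le v u : tadj t v u -> (depth t u <= (depth t v).+1)%N.
Proof.
have [_ _ conn _] := tree_axioms.
rewrite /depth; have [p [ep lp <-]] := connect_shortest (conn root v) => evu.
rewrite -(size_rcons p u); apply: gdist_le_size; last by rewrite last_rcons.
by rewrite rcons_path ep lp.
Qed.

(** The last vertex before u on a shortest path from the root is a parent. *)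
Lemma parent_exists u : u != root -> exists v, is_parent t v u.
Proof.
have [_ _ conn _] := tree_axioms.
have [p [+ + sp]] := connect_shortest (conn root u).
case: (lastP p) sp => [|q x] sp /=; first by move=> _ ->; rewrite eqxx.
rewrite rcons_path last_rcons => /andP[eq ex] xu _.
have le_vq : (depth t (last root q) <= size q)%N := gdist_le_size eq erefl.
exists (last root q); rewrite /is_parent -xu ex eqn_leq depth_adj_le//=.
by rewrite /depth xu -sp size_rcons ltnS.
Qed.

Definition tadj_below k : rel 'I_n.+1 :=
  fun x y => [&& tadj t x y, depth t x < k & depth t y < k]%N.

(** A vertex is joined to the root through its ancestors, whose depths are
    smaller. *)
Lemma connect_below k v : (depth t v < k)%N -> connect (tadj_below k) root v.
Proof.
elim: {v}(depth t v) {-2}v (erefl (depth t v)) => [|m IHm] v dv lt_vk.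
  by have [->|/depth_gt0] := eqVneq v root; rewrite ?connect0 ?dv.
have [w /andP[ewv /eqP dwv]] : exists w, is_parent t w v.
  by apply: parent_exists; apply: contra_eq_neq dv => ->; rewrite depth_root.
have dw : depth t w = m by move: dwv; rewrite dv => -[].
apply: connect_trans (IHm w dw _) (connect1 _); first lia.
by apply/and3P; split=> //; lia.
Qed.

(** Two distinct parents of u would be joined by a path through vertices of
    smaller depth than u, which u would close into a cycle. *)
Lemma parent_unique u v1 v2 : is_parent t v1 u -> is_parent t v2 u -> v1 = v2.
Proof.
have [sym _ _ acyclic] := tree_axioms.
move=> /andP[e1 /eqP d1] /andP[e2 /eqP d2].
have lt1 : (depth t v1 < depth t u)%N by rewrite d1.
have lt2 : (depth t v2 < depth t u)%N by rewrite d2.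
set k := depth t u in lt1 lt2.
pose r := tadj_below k.
have symr : connect_sym r.
  apply: sym_connect_sym => x y; rewrite /r /tadj_below sym; congr (_ && _).
  exact: andbC.
have : connect r v1 v2.
  by apply: (connect_trans (y := root)); [rewrite symr|]; exact: connect_below.
move=> /connectP[p0 /shortenP[p rp up _] v2E].
have ep : path (tadj t) v1 p by apply: sub_path rp => x y /and3P[].
(* Every vertex of the path is less deep than u, so u is new. *)
have u_p : u \notin v1 :: p.
  have : all [pred x | depth t x < k]%N (v1 :: p).
    rewrite /= lt1/=; elim: p v1 rp {lt1 e1 d1 up v2E ep} => //= x p IHp w.
    by move=> /andP[/and3P[_ _ ->]]; apply: IHp.
  by apply: contraL => u_p; apply/allPn; exists u; rewrite //= ltnn.
have /acyclic : ucycle (tadj t) [:: u, v1 & p].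
  rewrite /ucycle cons_uniq u_p up.
  by rewrite /cycle rcons_cons/= rcons_path ep -v2E sym e1 e2.
by case: p v2E {rp up ep u_p} => [->//|x p _].
Qed.

(** The default value is only taken at the root, which has no parent. *)
Definition parent (u : 'I_n.+1) : 'I_n.+1 :=
  odflt root [pick v | is_parent t v u].

Lemma parentP u : u != root -> is_parent t (parent u) u.
Proof.
move=> /parent_exists[v vu]; rewrite /parent.
by case: pickP => [//|/(_ v)]; rewrite vu.
Qed.

Lemma is_parent_parent v u : is_parent t v u -> u != root /\ v = parent u.
Proof.
move=> vu; have ur : u != root.
  by apply: contraTneq vu => ->; rewrite /is_parent depth_root andbF.
by split=> //; exact: parent_unique vu (parentP ur).
Qed.

(** The set A consists of u and its ancestors other than the root, and the sum
    telescopes along the path from the root to u. *)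
Lemma ancestors_exist u :
  exists A : {set 'I_n.+1}, [/\ #|A| = depth t u, root \notin A
    & forall (G : zmodType) (f : 'I_n.+1 -> G),
        f u - f root = \sum_(v in A) (f v - f (parent v))].
Proof.
(* The bound on depths shows that u is not among the ancestors of its parent. *)
suff [A [cA A_le rA fA]] : exists A : {set 'I_n.+1},
    [/\ #|A| = depth t u, forall v, v \in A -> (depth t v <= depth t u)%N, root \notin A
    & forall (G : zmodType) (f : 'I_n.+1 -> G),
        f u - f root = \sum_(v in A) (f v - f (parent v))].
  by exists A.
elim: {u}(depth t u) {-2}u (erefl (depth t u)) => [|m IHm] u du.
  exists finset.set0; split=> [|v||G f]; rewrite ?cards0 ?finset.in_set0//.
  rewrite big_set0; by have [->|/depth_gt0] := eqVneq u root; rewrite ?subrr ?du.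
have ur : u != root by apply: contra_eq_neq du => ->; rewrite depth_root.
have /andP[_ /eqP dp] := parentP ur.
have dpu : depth t (parent u) = m by move: dp; rewrite du => -[].
have [A [cA A_le rA fA]] := IHm _ dpu.
have u_A : u \notin A by apply/negP => /A_le; rewrite du; lia.
exists (u |: A)%SET; split=> [|v||G f].
- by rewrite cardsU1 u_A cA add1n.
- by rewrite finset.in_setU1 => /predU1P[->//|/A_le]; lia.
- by rewrite finset.in_setU1 negb_or eq_sym ur.
- by rewrite big_setU1//= -fA addrA subrK.
Qed.

End Tree.

(** * Measure and integration *)

Lemma measure_preimage_partition (R : realType) d (Om : measurableType d)
    (mu : {measure set Om -> \bar R}) (I : finType) (T : Om -> I) (A : set Om) :
  (forall i, measurable (A `&` T @^-1` [set i])) ->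
  (mu A = \sum_i mu (A `&` T @^-1` [set i]))%E.
Proof.
move=> mAT; pose F i := A `&` T @^-1` [set i].
rewrite fsbig_seq; last exact: index_enum_uniq.
rewrite -measure_fsbig//.
- rewrite -fsbig_seq; last exact: index_enum_uniq.
  rewrite -bigcup_seq; congr (mu _); apply/seteqP; split=> [w Aw|w [i _ []]//].
  by exists (T w); rewrite //= mem_index_enum.
- by move=> i j _ _ [w [[_ /= <-] [_ /= <-]]].
Qed.

(** Pushing forward the pair turns independence into a product law, and Fubini
    then integrates the centered factor first. *)
Lemma integral_mul_indep_centered (R : realType) d d1 d2 (Om : measurableType d)
    (S1 : measurableType d1) (S2 : measurableType d2)
    (mu : {measure set Om -> \bar R})
    (m1 : {sigma_finite_measure set S1 -> \bar R})
    (m2 : {sigma_finite_measure set S2 -> \bar R})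
    (X : Om -> S1) (Y : Om -> S2) (f : S1 -> R) (g : S2 -> R) :
  measurable_fun setT X -> measurable_fun setT Y ->
  (forall A B, measurable A -> measurable B ->
     mu (X @^-1` A `&` Y @^-1` B) = m1 A * m2 B)%E ->
  m1.-integrable setT (EFin \o f) -> m2.-integrable setT (EFin \o g) ->
  (\int[m2]_y (g y)%:E = 0)%E ->
  (mu.-integrable setT (fun w => (f (X w) * g (Y w))%:E) /\
   \int[mu]_w (f (X w) * g (Y w))%:E = 0)%E.
Proof.
move=> mX mY XY if_ ig g0.
have mf : measurable_fun setT f by apply/measurable_EFinP; exact: measurable_int if_.
have mg : measurable_fun setT g by apply/measurable_EFinP; exact: measurable_int ig.
pose XY_ w := (X w, Y w).
have mXY : measurable_fun setT XY_ by exact: measurable_fun_pair.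
pose h (z : S1 * S2) : \bar R := (f z.1 * g z.2)%:E.
have mh : measurable_fun setT h.
  apply/measurable_EFinP; apply: measurable_funM.
    exact: measurableT_comp mf measurable_fst.
  exact: measurableT_comp mg measurable_snd.
have lawE A : measurable A -> A `<=` setT -> pushforward mu XY_ A = (m1 \x m2)%E A.
  move=> mA _; apply/esym.
  apply: (@product_measure_unique _ _ _ _ _ m1 m2 (pushforward mu XY_)) mA.
  exact: XY.
have [mf' if_lty] := integrableP _ _ _ if_.
have [mg' ig_lty] := integrableP _ _ _ ig.
have mabsf : measurable_fun setT (fun x => `|(f x)%:E|)%E by exact: measurableT_comp mf'.
have mabsg : measurable_fun setT (fun x => `|(g x)%:E|)%E by exact: measurableT_comp mg'.
have ih : (m1 \x m2)%E.-integrable setT h.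
  apply/integrable12ltyP => //.
  rewrite (eq_integral (fun x => `|(f x)%:E| * \int[m2]_y `|(g y)%:E|)%E); last first.
    move=> x _; rewrite -ge0_integralZl//.
    by apply: eq_integral => y _; rewrite /h/= normrM EFinM.
  rewrite ge0_integralZr//; last exact: integral_ge0.
  by rewrite lte_mul_pinfty// ?ge0_fin_numE// integral_ge0.
have imuh : mu.-integrable setT (h \o XY_).
  apply/integrableP; split; first exact: measurableT_comp.
  have := ge0_integral_pushforward mXY mu measurableT (measurableT_comp (@abse_measurable R setT) mh).
  rewrite preimage_setT => <-; last by move=> z _; exact: abse_ge0.
    rewrite (eq_measure_integral _ lawE).
    by have [] := integrableP _ _ _ ih.
  exact: mXY.
split; first exact: imuh.
have := integral_pushforward mXY mh (mu := mu) (D := setT).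
rewrite preimage_setT => /(_ imuh measurableT) <-.
rewrite (eq_measure_integral _ lawE) -?integral12_prod_meas1//.
rewrite integral0_eq// => x _; rewrite /fubini_F /h/=.
under eq_integral do rewrite EFinM.
by rewrite integralZl// g0 mule0.
Qed.

(** Pythagoras' theorem in L2: after expanding the square, only the diagonal
    terms survive. *)
Lemma integral_sqr_sum_orthogonal (R : realType) d (Om : measurableType d)
    (mu : {measure set Om -> \bar R}) (I : finType) (A : {set I})
    (f : I -> Om -> R) :
  (forall i j, i \in A -> j \in A ->
     mu.-integrable setT (fun w => (f i w * f j w)%:E)) ->
  (forall i j, i \in A -> j \in A -> i != j ->
     \int[mu]_w (f i w * f j w)%:E = 0)%E ->
  (\int[mu]_w ((\sum_(i in A) f i w) ^+ 2)%:E =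
   \sum_(i in A) \int[mu]_w ((f i w) ^+ 2)%:E)%E.
Proof.
move=> int_f orth.
pose F (p : I * I) w := if (p.1 \in A) && (p.2 \in A)
  then (f p.1 w * f p.2 w)%:E else 0%E.
have int_F p : mu.-integrable setT (F p).
  rewrite /F; have [/andP[iA jA]|_] := boolP ((p.1 \in A) && (p.2 \in A)).
    exact: int_f.
  exact: integrable0.
transitivity (\int[mu]_w (\sum_(p : I * I) F p w))%E.
  apply: eq_integral => w _.
  rewrite -big_mkcond/= -(pair_big (mem A) (mem A) (fun i j => (f i w * f j w)%:E))/=.
  rewrite expr2 mulr_suml -sumEFin; apply: eq_bigr => i _.
  by rewrite mulr_sumr -sumEFin.
rewrite integral_sum// (eq_bigr (fun p : I * I => if (p.1 \in A) && (p.2 \in A)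
    then \int[mu]_w (f p.1 w * f p.2 w)%:E else 0)%E); last first.
  move=> p _; rewrite /F.
  by have [_|_] := boolP ((p.1 \in A) && (p.2 \in A)); rewrite ?integral0.
rewrite -big_mkcond/= -(pair_big (mem A) (mem A)
  (fun i j => \int[mu]_w (f i w * f j w)%:E)%E)/=.
apply: eq_bigr => i iA; rewrite (bigD1 i)//= big1 ?adde0// => j /andP[jA ji].
by rewrite orth// eq_sym.
Qed.

(** Markov's inequality for the number of events that occur. *)
Lemma markov_card (R : realType) d (Om : measurableType d)
    (mu : {measure set Om -> \bar R}) (J : finType) (B : J -> Om -> bool) (a : R) :
  (forall j, measurable [set w | B j w]) -> 0 < a ->
  (a%:E * mu [set w | (a <= #|[pred j | B j w]|%:R)%R] <=
   \sum_j mu [set w | B j w])%E.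
Proof.
move=> mB a0; pose f w := (\sum_j \1_[set w | B j w] w : R)%R.
have fE w : f w = #|[pred j | B j w]|%:R.
  rewrite /f -sum1_card natr_sum [RHS]big_mkcond; apply: eq_bigr => j _.
  rewrite indicE (_ : (w \in _) = B j w) ?inE; first by case: (B j w).
  by apply/idP/idP; rewrite inE.
have mf : measurable_fun setT (fun w => (f w)%:E).
  by apply/measurable_EFinP; apply: measurable_sum => j; exact: measurable_indic.
have := le_integral_abse mu measurableT mf a0.
rewrite setTI; under eq_integral do rewrite gee0_abs ?lee_fin ?fE ?ler0n// -fE -sumEFin.
rewrite ge0_integral_sum//; last first.
  by move=> j; apply/measurable_EFinP; exact: measurable_indic.
under [X in (_ <= X)%E -> _]eq_bigr do rewrite integral_indic// setIT.
congr (_ * mu _ <= _)%E; apply/seteqP; split=> w /=;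
  by rewrite lee_fin fE normr_nat.
Qed.

(** * Second moments of a tree-indexed walk *)

Section Walk.
Variables (R : realType) (d : nat) (theta : probability (lattice d) R)
    (dO : measure_display) (Omega : measurableType dO)
    (P : probability Omega R) (n : nat)
    (T : Omega -> rooted_tree n) (W : Omega -> 'I_n.+1 -> lattice d).
Hypothesis tw : is_tree_walk theta P T W.

(** The pair formed by the tree and the walk takes countably many values. *)
Lemma measurable_tree_walk_event
    (Q : rooted_tree n -> ('I_n.+1 -> lattice d) -> Prop) :
  measurable [set w | Q (T w) (W w)].
Proof.
rewrite (_ : [set _ | _] =
  \bigcup_(p : rooted_tree n * {ffun 'I_n.+1 -> 'rV[int]_d})
    [set w | [/\ Q p.1 p.2, T w = p.1 & forall u, W w u = p.2 u]]); last first.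
  apply/seteqP; split=> [w Qw|w [[t g]] _ /= [Qtg -> Wg]].
    exists (T w, [ffun u => W w u : 'rV[int]_d]) => //=.
    split=> [||u]; rewrite ?ffunE//; apply: (eq_ind (W w) (Q (T w)) Qw).
    by apply/funext => u; rewrite ffunE.
  by have -> : W w = g by apply/funext => u; rewrite Wg.
apply: countable_bigcupT_measurable => [|[t g]]; first exact: countableP.
have [Qtg|nQ] := pselect (Q t g); last first.
  by rewrite (_ : [set _ | _] = set0)//; apply/seteqP; split=> // w [].
rewrite (_ : [set _ | _] =
    T @^-1` [set t] `&` \bigcap_u ((fun w => W w u) @^-1` [set (g u : lattice d)])).
  apply: measurableI; first exact: (tree_measurable tw).
  apply: fin_bigcap_measurable => // u _.
  rewrite -[X in measurable X]setTI; exact: (walk_measurable tw u).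
apply/seteqP; split=> w /=; first by case=> _ -> Wg; split=> // u _; exact: Wg.
by move=> [-> Wg]; split=> // u; exact: Wg.
Qed.

Definition increment (t : rooted_tree n) (u : 'I_n.+1) (w : Omega) : lattice d :=
  W w u - W w (parent t u).

Lemma measurable_increment t u : measurable_fun setT (increment t u).
Proof.
move=> _ A _; rewrite setTI.
exact: (measurable_tree_walk_event (fun _ X => A (X u - X (parent t u)))).
Qed.

(** Each vertex other than the root has exactly one parent, so the conditions
    indexed by edges in the definition of a walk are conditions indexed by
    vertices. *)
Lemma increments_law t (A : 'I_n.+1 -> set (lattice d)) :
  (P ([set w | forall u, u != troot t -> A u (increment t u w)] `&` [set w | T w = t])
   = P [set w | T w = t] * (\prod_(u | u != troot t) fine (theta (A u)))%:E)%E.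
Proof.
rewrite -(walk_increments tw); congr (P _); apply/seteqP; split=> w /=.
  by move=> [Aw ->]; split=> // v u /is_parent_parent[ur ->]; exact: Aw.
by move=> [-> Aw]; split=> // u /parentP; exact: Aw.
Qed.

Lemma increment_law t u A : u != troot t ->
  (P (increment t u @^-1` A `&` [set w | T w = t]) = P [set w | T w = t] * theta A)%E.
Proof.
move=> ur; pose B z := if z == u then A else setT.
rewrite (_ : _ `&` _ = [set w | forall z, z != troot t -> B z (increment t z w)]
    `&` [set w | T w = t]); last first.
  congr (_ `&` _); apply/seteqP; split=> w /= => [Aw z _|/(_ u ur)].
    by rewrite /B; case: eqP => [->|].
  by rewrite /B eqxx.
rewrite increments_law (bigD1 u)//= big1 ?mulr1; last first.
  by move=> z /andP[_ /negPf zu]; rewrite /B zu probability_setT.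
by rewrite /B eqxx fineK// fin_num_measure.
Qed.

Lemma increment_pair_law t u v A B : u != troot t -> v != troot t -> u != v ->
  (P ((increment t u @^-1` A `&` increment t v @^-1` B) `&` [set w | T w = t])
   = P [set w | T w = t] * theta A * theta B)%E.
Proof.
move=> ur vr uv; pose C z := if z == u then A else if z == v then B else setT.
have vu : (v == u) = false by rewrite eq_sym (negPf uv).
rewrite (_ : _ `&` _ = [set w | forall z, z != troot t -> C z (increment t z w)]
    `&` [set w | T w = t]); last first.
  congr (_ `&` _); apply/seteqP; split=> w /= => [[Aw Bw] z _|Cw].
    by rewrite /C; case: eqP => [->//|_]; case: eqP => [->|].
  by split; [have := Cw u ur|have := Cw v vr]; rewrite /C ?vu eqxx.
rewrite increments_law (bigD1 u)//= (bigD1 v) ?vr ?vu//= big1 ?mulr1; last first.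
  by move=> z /andP[/andP[_ /negPf zu] /negPf zv]; rewrite /C zu zv probability_setT.
by rewrite /C vu !eqxx EFinM !fineK ?fin_num_measure// muleA.
Qed.

Lemma coordB (i : 'I_d) (x y : lattice d) :
  coord R i (x - y) = coord R i x - coord R i y.
Proof. by rewrite /coord -rmorphB; congr (_%:~R); rewrite !mxE. Qed.

Section ConditionalMoment.
Variables (t : rooted_tree n) (i : 'I_d).
Hypothesis coord_integrable : theta.-integrable setT (EFin \o coord R i).
Hypothesis coord_mean0 : (\int[theta]_x (coord R i x)%:E = 0)%E.
Hypothesis coord_sqr_lty : (\int[theta]_x (coord R i x ^+ 2)%:E < +oo)%E.

(* The measure P is restricted to the event that the tree is t, and not
   conditioned on it: no division by a possibly null probability is needed. *)
Let mu : {measure set Omega -> \bar R} := mrestr P (tree_measurable tw [set t]).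
Let PT_ge0 : 0 <= fine (P [set w | T w = t]).
Proof. by rewrite fine_ge0. Qed.
Let p : {nonneg R} := NngNum PT_ge0.

Let PTE : (p%:num%:E = P [set w | T w = t])%E.
Proof. by rewrite /= fineK// fin_num_measure//; exact: (tree_measurable tw [set t]). Qed.

(* The law of an increment under mu. *)
Let m1 : {finite_measure set (lattice d) -> \bar R} := mscale p theta.

Lemma integral_increment_sqr u : u != troot t ->
  (\int[mu]_w ((coord R i (increment t u w)) ^+ 2)%:E =
   P [set w | T w = t] * \int[theta]_x (coord R i x ^+ 2)%:E)%E.
Proof.
move=> ur.
have := ge0_integral_pushforward (measurable_increment t u) mu (D := setT)
  (f := fun x => (coord R i x ^+ 2)%:E).
rewrite preimage_setT => /(_ measurableT _ _)/=.
move=> <-//; last by move=> x _; rewrite lee_fin sqr_ge0.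
rewrite -PTE -ge0_integral_mscale//; last by move=> x _; rewrite lee_fin sqr_ge0.
apply: eq_measure_integral => [|mX A mA _]; first exact: measurable_increment.
rewrite -[LHS]/(P (increment t u @^-1` A `&` [set w | T w = t])).
by rewrite increment_law// -PTE.
Qed.

Lemma integral_increment_orthogonal u v :
  u != troot t -> v != troot t -> u != v ->
  (mu.-integrable setT
     (fun w => (coord R i (increment t u w) * coord R i (increment t v w))%:E) /\
   \int[mu]_w (coord R i (increment t u w) * coord R i (increment t v w))%:E = 0)%E.
Proof.
move=> ur vr uv.
apply: (@integral_mul_indep_centered _ _ _ _ _ _ _ mu m1 theta) => //.
- exact: measurable_increment.
- exact: measurable_increment.
- move=> A B _ _; rewrite -[LHS]/(P ((increment t u @^-1` A `&`
    increment t v @^-1` B) `&` [set w | T w = t])).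
  by rewrite increment_pair_law// -PTE.
- apply/integrableP; split; first exact: measurable_int coord_integrable.
  rewrite ge0_integral_mscale//.
  have [_ lty] := integrableP _ _ _ coord_integrable.
  by rewrite lte_mul_pinfty// ?lee_fin.
Qed.

Lemma integral_walk_sqr u :
  (\int[mu]_w ((coord R i (W w u - W w (troot t))) ^+ 2)%:E =
   (P [set w | T w = t] * (depth t u)%:R%:E) * \int[theta]_x (coord R i x ^+ 2)%:E)%E.
Proof.
have [A [cA rA AE]] := ancestors_exist t u.
have AP v : v \in A -> v != troot t by apply: contraTneq => ->.
rewrite (eq_integral (fun w => ((\sum_(v in A) coord R i (increment t v w)) ^+ 2)%:E)); last first.
  move=> w _; rewrite coordB (AE R (fun v => coord R i (W w v))).
  by congr (_ ^+ 2)%:E; apply: eq_bigr => v _; rewrite coordB.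
rewrite (integral_sqr_sum_orthogonal (f := fun v w => coord R i (increment t v w))).
- rewrite (eq_bigr (fun=> P [set w | T w = t] *
      \int[theta]_x (coord R i x ^+ 2)%:E)%E); last first.
    by move=> v /AP; exact: integral_increment_sqr.
  by rewrite sumr_const cA; apply: etrans (esym (mule_natl _ _)) _; rewrite muleCA muleA.
- move=> v v' /AP vr /AP vr'; have [->|vv'] := eqVneq v v'; last first.
    by have [] := integral_increment_orthogonal vr vr' vv'.
  apply/integrableP; split.
    apply/measurable_EFinP; apply: measurable_funM;
      exact: measurableT_comp (measurable_increment _ _).
  under eq_integral do rewrite gee0_abs ?lee_fin -?expr2 ?sqr_ge0//.
  by rewrite integral_increment_sqr// -PTE lte_mul_pinfty// ?lee_fin.
- by move=> v v' /AP vr /AP vr' vv'; have [] := integral_increment_orthogonal vr vr' vv'.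
Qed.

(** Chebyshev's inequality.  The position is measured from the root of t, since
    the walk is known to vanish there only on the event that the tree is t. *)
Lemma walk_chebyshev u (r : R) : 0 < r ->
  ((r ^+ 2)%:E * P ([set w | (r <= `|coord R i (W w u)|)%R] `&` [set w | T w = t]) <=
   P [set w | T w = t] * ((depth t u)%:R%:E * \int[theta]_x (coord R i x ^+ 2)%:E))%E.
Proof.
move=> r0; rewrite muleA -integral_walk_sqr.
rewrite (_ : _ `&` _ = [set w | ((r ^+ 2)%:E <=
  `|((coord R i (W w u - W w (troot t))) ^+ 2)%:E|)%E] `&` [set w | T w = t]); last first.
  apply/seteqP; split=> w /= [+ Tt];
    rewrite -{1}Tt (walk_root tw) subr0 lee_fin normrX;
    by rewrite ler_pXn2r// nnegrE ?normr_ge0 ?ltW.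
have mg : measurable_fun setT
    (fun w => ((coord R i (W w u - W w (troot t))) ^+ 2)%:E).
  apply/measurable_EFinP => _ B _; rewrite setTI.
  exact: (measurable_tree_walk_event (fun _ X => B (coord R i (X u - X (troot t)) ^+ 2))).
have := le_integral_abse mu measurableT mg (exprn_gt0 2 r0).
rewrite setTI => /le_trans; apply.
by under eq_integral do rewrite gee0_abs ?lee_fin ?sqr_ge0//.
Qed.

End ConditionalMoment.

(** The conditional bound depends on the tree only through the depth of u, which
    is at most h on the event considered; summing over the possible trees
    removes the conditioning. *)
Lemma walk_chebyshev_height (i : 'I_d) (u : 'I_n.+1) (h r : R) :
  theta.-integrable setT (EFin \o coord R i) ->
  (\int[theta]_x (coord R i x)%:E = 0)%E ->
  (\int[theta]_x (coord R i x ^+ 2)%:E < +oo)%E ->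
  0 <= h -> 0 < r ->
  ((r ^+ 2)%:E *
     P [set w | ((height (T w))%:R <= h)%R /\ (r <= `|coord R i (W w u)|)%R] <=
   h%:E * \int[theta]_x (coord R i x ^+ 2)%:E)%E.
Proof.
move=> icoord coord0 coord2 h0 r0.
have mE (Q : rooted_tree n -> ('I_n.+1 -> lattice d) -> Prop) t :
    measurable ([set w | Q (T w) (W w)] `&` T @^-1` [set t]).
  apply: measurableI; first exact: measurable_tree_walk_event.
  exact: (tree_measurable tw).
rewrite (@measure_preimage_partition _ _ _ P _ T); last first.
  exact: (mE (fun t X => (height t)%:R <= h /\ (r <= `|coord R i (X u)|)%R)).
have PT : (\sum_t P [set w | T w = t] = 1)%E.
  rewrite -(probability_setT P) (@measure_preimage_partition _ _ _ P _ T).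
    by apply: eq_bigr => t _; rewrite setTI.
  exact: (mE (fun _ _ => True)).
rewrite ge0_sume_distrr; last by move=> t _; exact: measure_ge0.
have s0 : (0 <= \int[theta]_x (coord R i x ^+ 2)%:E)%E.
  by apply: integral_ge0 => x _; rewrite lee_fin sqr_ge0.
rewrite -[leRHS]mul1e -PT ge0_sume_distrl; last by move=> t _; exact: measure_ge0.
apply: lee_sum => t _.
have [ht|ht] := leP (height t)%:R h; last first.
  rewrite (_ : _ `&` _ = set0) ?measure0 ?mule0.
    by rewrite !mule_ge0// lee_fin.
  by apply/seteqP; split=> // w /= [[+ _] Tt]; rewrite Tt leNgt ht.
apply: le_trans (_ : (_ <= (r ^+ 2)%:E * P ([set w | (r <= `|coord R i (W w u)|)%R]
  `&` [set w | T w = t]))%E) _.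
  rewrite lee_pmul2l ?lte_fin ?exprn_gt0//; apply: le_measure; rewrite ?inE.
  - exact: (mE (fun t X => (height t)%:R <= h /\ (r <= `|coord R i (X u)|)%R)).
  - exact: (mE (fun t X => (r <= `|coord R i (X u)|)%R)).
  - by move=> w [[_ rw] Tt].
apply: le_trans (walk_chebyshev _ _ _ _ _ _) _ => //.
rewrite lee_wpmul2l// lee_wpmul2r// lee_fin (le_trans _ ht)// ler_nat.
exact: (leq_bigmax_cond (F := depth t)).
Qed.

End Walk.

(** * Range and far vertices *)

(** The positions in the box of radius m are at most (2m + 1)^d, and each other
    position is charged to a vertex and to a coordinate of it that exceeds m. *)
Lemma walk_range_le n d (X : 'I_n.+1 -> lattice d) (m : nat) :
  (walk_range X <= (2 * m).+1 ^ d +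
     #|[pred ui : 'I_n.+1 * 'I_d | m < `|X ui.1 ord0 ui.2|]|)%N.
Proof.
rewrite /walk_range; set S := undup _.
pose inbox (x : lattice d) := [forall i : 'I_d, `|x ord0 i| <= m]%N.
rewrite -(count_predC inbox S); apply: leq_add.
  (* Shifting the coordinates by m makes them natural numbers up to 2m. *)
  pose code (x : lattice d) : {ffun 'I_d -> 'I_(2 * m).+1} :=
    [ffun i => inord (absz (x ord0 i + m%:Z))].
  have codeI : {in seq.filter inbox S &, injective code}.
    move=> x y; rewrite !mem_filter => /andP[/forallP nx _] /andP[/forallP ny _].
    move=> /ffunP xy; apply/rowP => i; have := xy i; rewrite !ffunE.
    move: (nx i) (ny i) => {}nx {}ny /(congr1 (@nat_of_ord _)).
    rewrite -[ord0]/(0 : 'I_1) in nx ny *.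
    by rewrite !inordK; lia.
  rewrite -size_filter -(size_map code).
  have /card_uniqP <- : uniq (map code (seq.filter inbox S)).
    by rewrite map_inj_in_uniq ?filter_uniq ?undup_uniq.
  by rewrite (leq_trans (max_card _))// card_ffun !card_ord.
rewrite -size_filter.
pose far := [pred ui : 'I_n.+1 * 'I_d | m < `|X ui.1 ord0 ui.2|]%N.
rewrite -/far cardE -(size_map (fun ui => X ui.1)).
apply: uniq_leq_size => [|x]; first by rewrite filter_uniq ?undup_uniq.
rewrite mem_filter mem_undup /inbox /= negb_forall => /andP[/existsP[i far_i]].
move=> /codomP[u xE]; apply/mapP; exists (u, i) => //.
by rewrite mem_enum inE/= -xE ltnNge.
Qed.

Lemma norm_coord (R : realType) d (i : 'I_d) (x : lattice d) :
  `|coord R i x| = (absz (x ord0 i))%:R.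
Proof. by rewrite /coord -intr_norm -abszE pmulrn. Qed.

(** If the range exceeds the size of the box by a, then at least a pairs of a
    vertex and a coordinate are far.  Markov's inequality bounds the probability
    of this event by the expected number of such pairs, and Chebyshev's
    inequality bounds each term of that expectation. *)
Lemma walk_range_tail (R : realType) d (theta : probability (lattice d) R)
    dO (Omega : measurableType dO) (P : probability Omega R) n
    (T : Omega -> rooted_tree n) (W : Omega -> 'I_n.+1 -> lattice d)
    (h a : R) (m : nat) :
  is_tree_walk theta P T W -> centered theta ->
  (forall i : 'I_d, \int[theta]_x (coord R i x ^+ 2)%:E < +oo)%E ->
  0 <= h -> 0 < a ->
  ((a * m.+1%:R ^+ 2)%:E *
     P [set w | ((height (T w))%:R <= h)%R /\
                (((2 * m).+1 ^ d)%N%:R + a <= (walk_range (W w))%:R)%R] <=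
   (n.+1%:R * h)%:E * \sum_i \int[theta]_x (coord R i x ^+ 2)%:E)%E.
Proof.
move=> tw centr sqr_lty h0 a0.
pose B (ui : 'I_n.+1 * 'I_d) w :=
  ((height (T w))%:R <= h) && (m.+1%:R <= `|coord R ui.2 (W w ui.1)|).
have mB ui : measurable [set w | B ui w].
  exact: (measurable_tree_walk_event tw (fun t X =>
    ((height t)%:R <= h) && (m.+1%:R <= `|coord R ui.2 (X ui.1)|))).
have m0 : 0 < (m.+1%:R : R) by rewrite ltr0n.
rewrite mulrC EFinM -muleA.
apply: (@le_trans _ _ ((m.+1%:R ^+ 2)%:E * \sum_ui P [set w | B ui w])%E).
  rewrite lee_pmul2l ?lte_fin ?exprn_gt0//.
  apply: (le_trans _ (markov_card P mB a0)).
  rewrite lee_pmul2l ?lte_fin//; apply: le_measure; rewrite ?inE.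
  - exact: (measurable_tree_walk_event tw (fun t X => ((height t)%:R <= h)%R /\
      (((2 * m).+1 ^ d)%N%:R + a <= (walk_range X)%:R)%R)).
  - exact: (measurable_tree_walk_event tw (fun t X => a <= #|[pred ui |
      ((height t)%:R <= h) && (m.+1%:R <= `|coord R ui.2 (X ui.1)|)]|%:R)).
  move=> w [hw aw] /=.
  have -> : #|[pred ui | B ui w]| =
      #|[pred ui : 'I_n.+1 * 'I_d | m < `|W w ui.1 ord0 ui.2|]|%N.
    by apply: eq_card => ui; rewrite !inE /B hw norm_coord ler_nat.
  have := walk_range_le (W w) m; rewrite -(ler_nat R) natrD; lra.
rewrite ge0_sume_distrr; last by move=> ui _; exact: measure_ge0.
apply: (@le_trans _ _ (\sum_(ui : 'I_n.+1 * 'I_d)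
    h%:E * \int[theta]_x (coord R ui.2 x ^+ 2)%:E)%E).
  apply: lee_sum => -[u i] _ /=; have [ci c0] := centr i.
  rewrite unlock in c0.
  apply: (le_trans _ (walk_chebyshev_height tw u ci c0 (sqr_lty i) h0 m0)).
  rewrite (_ : [set w | B (u, i) w] = [set w | ((height (T w))%:R <= h) /\
    (m.+1%:R <= `|coord R i (W w u)|)])//.
  by apply/seteqP; split=> w /andP.
rewrite -(pair_bigA _ (fun (_ : 'I_n.+1) i => h%:E * \int[theta]_x (coord R i x ^+ 2)%:E)%E)/=.
have s0 i : (0 <= \int[theta]_x (coord R i x ^+ 2)%:E)%E.
  by apply: integral_ge0 => x _; rewrite lee_fin sqr_ge0.
rewrite sumr_const card_ord -ge0_sume_distrr; last by move=> i _.
by rewrite EFinM -muleA mule_natl.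
Qed.

Lemma powRN_cvg0 (R : realType) (e : R) : 0 < e ->
  (n%:R : R) `^ (- e) @[n --> \oo] --> (0 : R).
Proof.
move=> e0; apply/cvgrPdist_le => /= c c0.
near=> n.
have ng : c `^ (- e^-1) <= n%:R :> R by near: n; exact: nbhs_infty_ger.
rewrite sub0r normrN ger0_norm ?powR_ge0// powRN.
rewrite invf_ple ?posrE ?powR_gt0//; last first.
  by apply: lt_le_trans ng; rewrite powR_gt0.
have -> : c^-1 = (c `^ (- e^-1)) `^ e.
  by rewrite -powRrM mulNr mulVf ?gt_eqF// powR_inv1// ltW.
by rewrite ge0_ler_powR ?nnegrE ?powR_ge0// ltW.
Unshelve. all: by end_near.
Qed.

Lemma integral_coord_sqr_lty (R : realType) d (theta : probability (lattice d) R)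
    (i : 'I_d) :
  finite_moment theta 2 -> (\int[theta]_x (coord R i x ^+ 2)%:E < +oo)%E.
Proof.
rewrite /finite_moment unlock; apply: le_lt_trans.
apply: ge0_le_integral => //= [x _|x _]; first by rewrite lee_fin sqr_ge0.
rewrite lee_fin (powR_mulrn 2) ?sqrtr_ge0// sqr_sqrtr ?sumr_ge0//; last first.
  by move=> j _; exact: sqr_ge0.
by rewrite (bigD1 i)//= lerDl sumr_ge0// => j _; exact: sqr_ge0.
Qed.

(** The quantitative form of the theorem, with s = 1/D.  The box has radius
    n^(s/2 + eps): its size is at most half of e n by the assumption on n, and
    the square of its radius exceeds the height n^(s + eps) by the factor n^eps
    that remains in the conclusion. *)
Lemma walk_range_prob_le (R : realType) d (theta : probability (lattice d) R)
    dO (Omega : measurableType dO) (P : probability Omega R) n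
    (T : Omega -> rooted_tree n) (W : Omega -> 'I_n.+1 -> lattice d)
    (e s eps : R) :
  is_tree_walk theta P T W -> centered theta ->
  (forall i : 'I_d, \int[theta]_x (coord R i x ^+ 2)%:E < +oo)%E ->
  (0 < n)%N -> 0 < e ->
  0 < s -> 0 < eps ->
  (n%:R `^ (- (1 - (s / 2 + eps) * d%:R)) <= e / 2 / 3 ^+ d) ->
  (P [set w | (e < `|(walk_range (W w))%:R / n%:R - 0|)%R] <=
   P [set w | (n%:R `^ (s + eps) <= (height (T w))%:R :> R)%R] +
   (4 / e * fine (\sum_(i < d) \int[theta]_x (coord R i x ^+ 2)%:E) *
      n%:R `^ (- eps))%:E)%E.
Proof.
move=> tw centr sqr_lty n0 e0 s0 eps0 nlarge.
have nR : 0 < (n%:R : R) by rewrite ltr0n.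
set K := fine _.
set al := s / 2 + eps in nlarge *.
pose m := Num.truncn ((n%:R : R) `^ al).
pose h : R := n%:R `^ (s + eps).
have h0 : 0 <= h by exact: powR_ge0.
pose a := e / 2 * n%:R : R.
have a0 : 0 < a by rewrite !mulr_gt0// invr_gt0.
have mle : m%:R <= (n%:R : R) `^ al by rewrite truncn_le powR_ge0.
have mgt : (n%:R : R) `^ al < m.+1%:R by exact: truncnS_gt.
have al0 : 0 < al by rewrite addr_gt0// divr_gt0.
have nal1 : 1 <= (n%:R : R) `^ al.
  by have := @ler_powR _ (n%:R : R) _ _ _ (ltW al0); rewrite powRr0 ler1n; apply.
(* The constant 3 comes from 2m + 1 <= 3 n^al, valid since n^al >= 1. *)
have box_le : ((2 * m).+1 ^ d)%N%:R <= a.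
  have -> : a = e / 2 / 3 ^+ d * n%:R * 3 ^+ d.
    by rewrite [RHS]mulrAC divfK// expf_neq0.
  rewrite natrX (@le_trans _ _ ((3 * n%:R `^ al) ^+ d))//.
    by rewrite lerXn2r ?nnegrE// ?mulr_ge0 ?powR_ge0// -natr1 natrM; lra.
  rewrite exprMn mulrC ler_wpM2r ?exprn_ge0//.
  rewrite -powR_mulrn ?powR_ge0// -powRrM.
  rewrite (_ : al * d%:R = - (1 - al * d%:R) + 1); last ring.
  rewrite powRD; last by rewrite (gt_eqF nR) implybT.
  by rewrite powRr1 ?ler0n// ler_wpM2r ?ler0n.
pose S := (\sum_(i < d) \int[theta]_x (coord R i x ^+ 2)%:E)%E.
have coord_sqr_ge0 (i : 'I_d) : (0 <= \int[theta]_x (coord R i x ^+ 2)%:E)%E.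
  by apply: integral_ge0 => x _; rewrite lee_fin sqr_ge0.
have K0 : 0 <= K by rewrite fine_ge0// sume_ge0.
have SE : S = K%:E.
  by rewrite /K fineK// ge0_fin_numE ?sume_ge0//; exact: lte_sum_pinfty.
have := walk_range_tail m tw centr sqr_lty h0 a0.
rewrite -/S SE -EFinM => tail.
have mh : measurable [set w | (h <= (height (T w))%:R :> R)%R].
  exact: (measurable_tree_walk_event tw (fun t X => h <= (height t)%:R)).
have mt : measurable [set w | ((height (T w))%:R <= h)%R /\
     (((2 * m).+1 ^ d)%N%:R + a <= (walk_range (W w))%:R)%R].
  exact: (measurable_tree_walk_event tw (fun t X => (height t)%:R <= h /\
     (((2 * m).+1 ^ d)%N%:R + a <= (walk_range X)%:R)%R)).
apply: (@le_trans _ _ (P ([set w | (h <= (height (T w))%:R :> R)%R] `|`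
   [set w | ((height (T w))%:R <= h)%R /\
     (((2 * m).+1 ^ d)%N%:R + a <= (walk_range (W w))%:R)%R]))).
  apply: le_measure; rewrite ?inE.
  - exact: (measurable_tree_walk_event tw (fun t X =>
      e < `|(walk_range X)%:R / n%:R - 0|)).
  - exact: measurableU.
  move=> w /=; rewrite subr0 ger0_norm ?divr_ge0// ltr_pdivlMr// => ew.
  have [hT|hT] := leP h (height (T w))%:R; [by left|right; split; first exact: ltW].
  by move: ew box_le; rewrite /a; lra.
apply: le_trans (measureU2 _ _ _) _ => //.
rewrite leeD2l//.
have am0 : 0 < a * m.+1%:R ^+ 2 by rewrite mulr_gt0// exprn_gt0 ?ltr0n.
rewrite -(@lee_pmul2l _ (a * m.+1%:R ^+ 2)%:E)// ?lte_fin//.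
apply: (le_trans tail).
rewrite -EFinM lee_fin.
have hE : h = n%:R `^ al ^+ 2 * n%:R `^ (- eps).
  rewrite -powR_mulrn ?powR_ge0// -powRrM -powRD; last by rewrite (gt_eqF nR) implybT.
  by rewrite /h /al; congr (_ `^ _); lra.
have -> : a * m.+1%:R ^+ 2 * (4 / e * K * n%:R `^ (- eps)) =
    (2 * n%:R) * (m.+1%:R ^+ 2 * n%:R `^ (- eps)) * K.
  by rewrite /a; field; rewrite gt_eqF.
apply: (ler_wpM2r K0); apply: ler_pM => //.
  by rewrite -natr1 mulr_natl mulr2n lerD2l ler1n.
rewrite hE; apply: (ler_wpM2r (powR_ge0 _ _)).
by rewrite lerXn2r ?nnegrE ?powR_ge0// ltW.
Qed.

(** * Recurrence *)

Theorem theorem1p3 (R : realType) (d : nat) (theta : probability (lattice d) R)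
    (D : R)
    (dO : nat -> measure_display) (Omega : forall n, measurableType (dO n))
    (P : forall n, probability (Omega n) R)
    (T : forall n, Omega n -> rooted_tree n)
    (W : forall n, Omega n -> 'I_n.+1 -> lattice d)
    (theta_centered : centered theta)
    (theta_cov : cov_mx theta \in unitmx)
    (D_gt1 : 1 < D)
    (walkW : forall n, is_tree_walk theta (P n) (T n) (W n))
    (height_le : forall e : R, 0 < e ->
      (P n [set w | (n%:R `^ (D^-1 + e) <= (height (T n w))%:R :> R)%R]
         @[n --> \oo] --> 0)%E)
    (theta_moment : forall delta : R, 0 < delta -> delta < 2 * D ->
      finite_moment theta delta)
    (d_lt2D : d%:R < 2 * D) :
  cvg_in_probability P (fun n w => (walk_range (W n w))%:R / n%:R) 0.
Proof.
have D0 : 0 < D by lra.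
set s : R := D^-1 in height_le *.
have s0 : 0 < s by rewrite invr_gt0.
have x1 : s / 2 * d%:R < 1.
  by rewrite mulrAC ltr_pdivrMr// mul1r mulrC ltr_pdivrMr.
(* With this eps, the exponent 1 - (s/2 + eps) d that measures how small the box
   is compared with n is again eps. *)
pose eps : R := (1 - s / 2 * d%:R) / d.+1%:R.
have eps0 : 0 < eps by rewrite divr_gt0 ?subr_gt0 ?ltr0n.
have b0 : 0 < 1 - (s / 2 + eps) * d%:R.
  have <- : eps = 1 - (s / 2 + eps) * d%:R.
    have d0 : (d%:R + 1 : R) != 0 by rewrite natr1 pnatr_eq0.
    by rewrite /eps -natr1; field.
  exact: eps0.
have sqr_lty (i : 'I_d) : (\int[theta]_x (coord R i x ^+ 2)%:E < +oo)%E.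
  by apply/integral_coord_sqr_lty/theta_moment; lra.
move=> e e0.
pose C := 4 / e * fine (\sum_(i < d) \int[theta]_x (coord R i x ^+ 2)%:E)%E.
apply: (@squeeze_cvge _ _ _ _ (cst 0%E) _ (fun n =>
  P n [set w | (n%:R `^ (s + eps) <= (height (T n w))%:R :> R)%R] +
  (C * n%:R `^ (- eps))%:E)%E).
- have c0 : 0 < e / 2 / 3 ^+ d by rewrite !divr_gt0 ?exprn_gt0.
  near=> n; rewrite measure_ge0/=.
  apply: walk_range_prob_le => //; first by near: n; exact: nbhs_infty_gt.
  rewrite -[leLHS]ger0_norm ?powR_ge0//; near: n.
  exact: (cvgr0_norm_le _ (powRN_cvg0 b0) _ c0).
- exact: cvg_cst.
- rewrite -[X in _ --> X]adde0; apply: cvgeD => //; first exact: height_le.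
  have -> : (0 = (C * 0)%:E)%E by rewrite mulr0.
  apply: cvg_EFin; first exact: nearW.
  by apply: cvgM; [exact: cvg_cst|exact: powRN_cvg0].
Unshelve. all: by end_near.
Qed.
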